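(* Let $q$ be a complex number with $0<|q|<1$ (equivalently, read the identities as identities of formal Laurent series in $q$). Then $$H_{A_7}(q)=\frac{q^{-1}}{(1-q)(q)_\infty^4}\Bigl(-1+(q)_\infty D(q)+G(q)+(q)_\infty\Bigr),$$ $$H_{A_8}(q)=\frac{q^{-2}}{(q)_\infty^4}\Bigl(-1+(q)_\infty+3D(q)-2G(q)\Bigr).$$
   Context: Notation: $(a)_n=(a;q)_n:=\prod_{j=0}^{n-1}(1-aq^j)$ for $n\in\mathbb{N}_0\cup\{\infty\}$; in particular $(q)_n=\prod_{j=1}^n(1-q^j)$ and $(q)_\infty=\prod_{j\ge1}(1-q^j)$. For $k\ge1$, $A_k$ is the path graph with $k$ nodes $1-2-\cdots-k$, and its graph series is $$H_{A_k}(q):=\sum_{(n_1,\dots,n_k)\in\mathbb{N}_0^k}\frac{q^{n_1n_2+n_2n_3+\cdots+n_{k-1}n_k+n_1+\cdots+n_k}}{(q)_{n_1}\cdots(q)_{n_k}}.$$ Further, $$D(q):=\sum_{n\ge1}\frac{q^n}{1-q^n},\qquad G(q):=\sum_{n\ge0}\bigl((q)_n-(q)_\infty\bigr).$$ *)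

(* Defs.v *)
From mathcomp Require Import all_boot all_order all_algebra.
From mathcomp Require Import finmap complex.
From mathcomp Require Import all_classical all_reals all_analysis.
From mathcomp Require Import summability.

Set Implicit Arguments.
Unset Strict Implicit.
Unset Printing Implicit Defensive.

Import Order.TTheory GRing.Theory Num.Theory.
Import numFieldNormedType.Exports.

Local Open Scope classical_set_scope.
Local Open Scope complex_scope.
Local Open Scope ring_scope.

(* The complex numbers are R[i] for R : realType. R[i] itself carries no      *)
(* topology; R[i]^o is the same type with its usual norm topology, hence the  *)
(* casts to R[i]^o under the limits.                                          *)

(* (a; q)_n for finite n *)
Definition qpoch (R : realType) (a q : R[i]) (n : nat) : R[i] :=
  \prod_(j < n) (1 - a * q ^+ j).

(* (a; q)_oo *)
Definition qpoch_inf (R : realType) (a q : R[i]) : R[i] :=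
  limn (fun n => qpoch a q n : R[i]^o).

Definition Dser (R : realType) (q : R[i]) : R[i] :=
  limn (fun N => \sum_(1 <= n < N) q ^+ n / (1 - q ^+ n) : R[i]^o).

Definition Gser (R : realType) (q : R[i]) : R[i] :=
  limn (fun N => \sum_(0 <= n < N) (qpoch q q n - qpoch_inf q q) : R[i]^o).

(* n_1 n_2 + ... + n_(k-1) n_k + n_1 + ... + n_k, with n_(i+1) = nth 0 n i    *)
Definition path_exponent (k : nat) (n : k.-tuple nat) : nat :=
  (\sum_(i < k.-1) nth 0 n i * nth 0 n i.+1 + \sum_(i < k) tnth n i)%N.

Definition path_term (R : realType) (k : nat) (q : R[i]) (n : k.-tuple nat) :
    R[i]^o :=
  q ^+ path_exponent n / \prod_(i < k) qpoch q q (tnth n i).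

(* H_(A_k)(q), the unordered sum over N^k: the limit of the partial sums over *)
(* finite subsets of N^k, directed by inclusion.                              *)
Definition path_series_cvg (R : realType) (k : nat) (q : R[i]) : Prop :=
  cvg (partial_sum (@path_term R k q) @ totally).

Definition path_series (R : realType) (k : nat) (q : R[i]) : R[i] :=
  summability.sum (@path_term R k q).

(* Main.v *)
Require Import Defs.
From mathcomp Require Import all_boot all_order all_algebra.
From mathcomp Require Import finmap complex.
From mathcomp Require Import all_classical all_reals all_analysis.
From mathcomp Require Import summability ring lra.
Import Order.TTheory GRing.Theory Num.Theory.
Import numFieldNormedType.Exports.
Local Open Scope complex_scope.
Local Open Scope ring_scope.

Set Implicit Arguments.
Unset Strict Implicit.

(** Write a_n = (q)_n, c = (q)_oo, and let w_n = q^n / a_n be the weight that one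
    node of the path contributes. Summing out an end node whose neighbour has
    the value m is the linear operator

      (L v)(m) = sum_n v(n) w_n q^(nm),

    so that H_(A_(k+1)) = <L^k 1, 1> for the pairing <u, v> = sum_n u(n) v(n) w_n
    ([path_seriesE]). All families are dominated by products of geometric
    series, so sums may be rearranged; in particular L is self-adjoint
    ([qpairing_transfer]), which amounts to summing the path from both ends:

      H_(A_7) = <L^3 1, L^3 1>,     H_(A_8) = <L (L^3 1), L^3 1>.

    The iterates have closed forms. Euler's identity gives (L 1)(m) = a_m / c,
    the geometric series gives (L a)(m) = 1 / (1 - q^(m+1)) =: r(m), and Euler's
    identity shifted by one gives (L r)(m) = q^-(m+1) (a_m / c - 1). Hence
    L^3 1 = c^-1 L r.

    Self-adjointness also supplies the two classical identities that bring in D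
    and G. Expanding <L r, 1> = <r, L 1> gives sum_n (1 - c / a_n) = D
    ([D_sums]), and expanding <L r, a> = <r, L a> gives
    sum_(n >= 1) (c / a_n) q^n / (1 - q^n) = G ([G_sums]).

    For k = 7 what remains is S = sum_n q^(-n) T_n with T_n = (a_n - c)^2 / a_n.
    Since q^(-n) = q q^(-(n+1)), the terms of S - q S combine to
    q^(-n) (T_n - T_(n+1)) = q (a_n - c^2 / a_(n+1)), a combination of the
    summands of D and G ([qpairing_recip_transfer]). For k = 8 the value of
    L (L r) at 0 is D up to a factor and at m + 1 it is r(m) - a_m up to the same
    factor, so that <L (L r), L r> splits into the sums above
    ([qpairing_transfer_recip_transfer]). *)

(** * Sequences, series and unordered sums over a field with a norm *)

Section Summation.
Local Open Scope classical_set_scope.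
#[local] Existing Instance totally_filter.
Variable K : numFieldType.
Implicit Types (T I J : choiceType).

Definition hasum T (f : T -> K) (s : K) :=
  partial_sum (f : T -> K^o) @ totally --> (s : K^o).

Definition tsum T (f : T -> K) : K := summability.sum (f : T -> K^o).

(** A field carries its norm topology only under the alias [K^o]. Confining the
    alias to this definition and the ones around it keeps the algebra below in [K]. *)
Definition tends (u : nat -> K) (l : K) := (u : nat -> K^o) @ \oo --> (l : K^o).

Definition nsum (f : nat -> K) (s : K) :=
  tends (fun n => \sum_(0 <= k < n) f k) s.

Lemma tends_unique u l m : tends u l -> tends u m -> l = m.
Proof. by move=> ul um; apply: (@cvg_unique K^o _ (u @ \oo)). Qed.

Lemma tends_lim u (l : K) : tends u l -> limn (u : nat -> K^o) = l.
Proof. by move=> h; apply: (@cvg_lim K^o _ _ _ _ _ _ h). Qed.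

Lemma tendsP u (l : K) : tends u l <->
  forall e : K, 0 < e -> exists N, forall n, (N <= n)%N -> `|l - u n| < e.
Proof.
split=> [/cvgrPdist_lt h e /h [N _ hN]|h]; first by exists N.
by apply/cvgrPdist_lt => e /h[N hN]; exists N.
Qed.

Lemma tends_cst (x : K) : tends (fun=> x) x.
Proof. exact: cvg_cst. Qed.

Lemma tendsD u v (l m : K) :
  tends u l -> tends v m -> tends (fun n => u n + v n) (l + m).
Proof. exact: cvgD. Qed.

Lemma tendsM u v (l m : K) :
  tends u l -> tends v m -> tends (fun n => u n * v n) (l * m).
Proof. exact: cvgM. Qed.

Lemma tendsZ (x : K) u l : tends u l -> tends (fun n => x * u n) (x * l).
Proof. by move=> h; apply: tendsM h; exact: tends_cst. Qed.

Lemma tendsB u v (l m : K) :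
  tends u l -> tends v m -> tends (fun n => u n - v n) (l - m).
Proof. exact: cvgB. Qed.

Lemma tendsV u (l : K) : l != 0 -> tends u l -> tends (fun n => (u n)^-1) l^-1.
Proof. by move=> l0; apply: cvgV. Qed.

Lemma tendsS u (l : K) : tends (fun n => u n.+1) l <-> tends u l.
Proof. by rewrite /tends -(@cvg_shiftS K^o u). Qed.

Lemma nsumD f g (s t : K) : nsum f s -> nsum g t ->
  nsum (fun n => f n + g n) (s + t).
Proof.
by move=> fs gt; rewrite /nsum; under eq_fun do rewrite big_split; exact: tendsD.
Qed.

Lemma nsumZ (x : K) f s : nsum f s -> nsum (fun n => x * f n) (x * s).
Proof.
by move=> fs; rewrite /nsum; under eq_fun do rewrite -big_distrr; exact: tendsZ.
Qed.

(** This shift replaces limit arguments: comparing a series with its shift turns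
    a recurrence between terms into a linear equation for the sum. *)
Lemma nsumS f (s : K) : nsum f s -> nsum (fun n => f n.+1) (s - f 0%N).
Proof.
rewrite {1}/nsum -tendsS => h; have := tendsB h (@tends_cst (f 0%N)).
congr (tends _ _); apply/funext => n.
by rewrite big_nat_recl // addrAC subrr add0r.
Qed.

Lemma nsum_cons f (s : K) : nsum (fun n => f n.+1) s -> nsum f (f 0%N + s).
Proof.
move=> h; apply/tendsS; have := tendsD (@tends_cst (f 0%N)) h.
by congr (tends _ _); apply/funext => n; rewrite big_nat_recl.
Qed.

Lemma nsum_ext f g (s t : K) : nsum f s -> f =1 g -> s = t -> nsum g t.
Proof. by move=> fs /funext <- <-. Qed.

Lemma nsum_unique f s t : nsum f s -> nsum f t -> s = t.
Proof. exact: tends_unique. Qed.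

(** Absolute summability is a bound on the finite sums of norms, so that it is
    inherited by dominated families without any limit being taken. *)
Definition absummable T (f : T -> K) :=
  exists M : K, forall A : {fset T}, \sum_(t <- A) `|f t| <= M.

Lemma partial_sumE T (f : T -> K) (A : {fset T}) :
  partial_sum (f : T -> K^o) A = \sum_(t <- A) f t.
Proof. by rewrite big_seq_fsetE. Qed.

Lemma hasumP T (f : T -> K) (s : K) : hasum f s <->
  forall e : K, 0 < e -> exists A0 : {fset T}, forall A : {fset T},
    (A0 `<=` A)%fset -> `|s - \sum_(t <- A) f t| < e.
Proof.
split=> [/cvgrPdist_lt fs e e0|h].
  have [A0 _ hA] := fs e e0; exists A0 => A sA.
  by have := hA A sA; rewrite /= partial_sumE.
apply/cvgrPdist_lt => e e0; have [A0 hA] := h e e0.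
by exists A0 => // A /hA; rewrite /= partial_sumE.
Qed.

Lemma hasum_unique T (f : T -> K) s t : hasum f s -> hasum f t -> s = t.
Proof. by move=> fs ft; apply: (@cvg_unique K^o _ _ _ s t fs ft). Qed.

Lemma hasumD T (f g : T -> K) s t :
  hasum f s -> hasum g t -> hasum (fun x => f x + g x) (s + t).
Proof.
move=> fs gt; rewrite /hasum.
suff -> : partial_sum (fun x => f x + g x : K^o) =
    partial_sum (f : T -> K^o) \+ partial_sum (g : T -> K^o).
  exact: cvgD.
by apply/funext => A /=; rewrite !partial_sumE big_split.
Qed.

Lemma hasumZ T (f : T -> K) s (a : K) :
  hasum f s -> hasum (fun x => a * f x) (a * s).
Proof.
move=> fs; rewrite /hasum.
suff -> : partial_sum (fun x => a * f x : K^o) = a \*: partial_sum (f : T -> K^o).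
  exact: cvgZl_tmp.
by apply/funext => A /=; rewrite !partial_sumE -big_distrr.
Qed.

Lemma ler_sum_fset T (f : T -> K) (A B : {fset T}) :
  (forall t, 0 <= f t) -> (A `<=` B)%fset ->
  \sum_(t <- A) f t <= \sum_(t <- B) f t.
Proof.
move=> f0 sAB.
have E : [fset x in B | x \in A]%fset = A.
  apply/fsetP => t; rewrite !inE /= andbC.
  by case: (boolP (t \in A)) => // /(fsubsetP sAB).
by rewrite (big_fsetID _ (mem A) B) /= E lerDl sumr_ge0.
Qed.

Lemma fset_nat_sub_iota (A : {fset nat}) :
  exists N, (A `<=` [fset i | i in index_iota 0 N])%fset.
Proof.
exists (\max_(i <- A) i).+1; apply/fsubsetP => i iA; apply: in_imfset => /=.
rewrite mem_index_iota /= ltnS.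
exact: (@leq_bigmax_seq _ (enum_fset A) xpredT id i iA isT).
Qed.

Lemma sum_fset_iota (f : nat -> K) N :
  \sum_(i <- [fset i | i in index_iota 0 N]%fset) f i = \sum_(0 <= i < N) f i.
Proof. by rewrite big_imfset //= undup_id ?iota_uniq. Qed.

Lemma hasum_nsum (f : nat -> K) s : hasum f s -> nsum f s.
Proof.
move=> /hasumP fs; apply/tendsP => e /fs[A0 hA].
have [N sA] := fset_nat_sub_iota A0.
exists N => // n hn; rewrite -(sum_fset_iota f); apply: hA.
apply: fsubset_trans sA _; apply/fsubsetP => i /imfsetP[j /=].
rewrite mem_index_iota => jN ->; apply: in_imfset => /=.
by rewrite mem_index_iota (leq_trans jN).
Qed.

Lemma hasum_reindex T T' (h : T' -> T) (f : T -> K) s :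
  bijective h -> hasum f s -> hasum (f \o h) s.
Proof.
move=> [h' hK h'K] /hasumP fs; apply/hasumP => e /fs[A0 hA].
exists [fset h' t | t in A0]%fset => A sA.
have := hA [fset h t | t in A]%fset; rewrite big_imfset /=; last first.
  by move=> x y _ _; apply: can_inj hK _ _.
apply; apply/fsubsetP => t tA; rewrite -[t]h'K; apply: in_imfset => /=.
by apply: (fsubsetP sA); apply: in_imfset.
Qed.

Lemma big_fsetX I J (f : I * J -> K) (A : {fset I}) (B : {fset J}) :
  \sum_(p <- (A `*` B)%fset) f p = \sum_(i <- A) \sum_(j <- B) f (i, j).
Proof.
rewrite -big_allpairs /=; apply: perm_big; apply: uniq_perm.
- exact: fset_uniq.
- by apply: allpairs_uniq => // -[a b] [c d].
move=> [i j]; rewrite inE /=; 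
apply/andP/allpairsP => [[iA jB]|[[a b] [aA bB [-> ->]]]] //.
by exists (i, j).
Qed.

(** For a finite set [B] of rows, a sufficiently large finite set of columns
    approximates all those row sums at once, since [B] is finite; the resulting
    rectangle can be chosen to contain the finite set beyond which the total sum
    is already approximated. *)
Lemma hasum_fubini I J (f : I * J -> K) (g : I -> K) s :
  hasum f s -> (forall i, hasum (fun j => f (i, j)) (g i)) -> hasum g s.
Proof.
move=> /hasumP fs fg; apply/hasumP => e e0.
have e20 : 0 < e / 2 by rewrite divr_gt0.
have [A0 hA] := fs _ e20; exists [fset p.1 | p in A0]%fset => B sB.
(* One finite set of columns serves all the rows listed in [r]. *)
have unif (d : K) : 0 < d -> forall r : seq I, exists J0 : {fset J},
    forall J' : {fset J}, (J0 `<=` J')%fset -> forall i, i \in r ->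
    `|g i - \sum_(j <- J') f (i, j)| < d.
  move=> d0; elim => [|i r [J0 hJ0]]; first by exists fset0.
  have /hasumP/(_ d d0)[J1 hJ1] := fg i.
  exists (J0 `|` J1)%fset => J'; rewrite fsubUset => /andP[s0 s1] i'.
  by rewrite inE => /predU1P[->|]; [exact: hJ1 | exact: hJ0].
(* The successor avoids a division by zero when [B] is empty. *)
set d := e / 2 / (size B).+1%:R.
have d0 : 0 < d by rewrite divr_gt0.
have [J0 hJ] := unif d d0 B.
pose J1 := (J0 `|` [fset p.2 | p in A0])%fset.
have sJ1 : (J0 `<=` J1)%fset by rewrite fsubsetUl.
have sA : (A0 `<=` B `*` J1)%fset.
  apply/fsubsetP => -[i j] ijA; rewrite inE /=; apply/andP; split.
    by apply: (fsubsetP sB); apply/imfsetP; exists (i, j).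
  by rewrite inE; apply/orP; right; apply/imfsetP; exists (i, j).
have := hA _ sA; rewrite big_fsetX => h1.
rewrite [X in _ < X]splitr.
rewrite -(subrKA (\sum_(i <- B) \sum_(j <- J1) f (i, j))).
apply: le_lt_trans (ler_normD _ _) _; apply: ltr_leD h1 _.
rewrite distrC -sumrB; apply: le_trans (ler_norm_sum _ _ _) _.
apply: (@le_trans _ _ (\sum_(i <- B) d)).
  by rewrite big_seq [leRHS]big_seq; apply: ler_sum => i iB; apply/ltW/hJ.
rewrite big_const_seq count_predT iter_addr_0 -[leLHS]mulr_natr /d.
rewrite -[leLHS]mulrA ler_piMr ?(ltW e20) //.
by rewrite mulrC ler_pdivrMr // mul1r ler_nat.
Qed.

Lemma hasum_norm_le T (f : T -> K) (s M : K) : hasum f s ->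
  (forall A : {fset T}, `|\sum_(t <- A) f t| <= M) -> `|s| <= 1 + M.
Proof.
move=> /hasumP/(_ 1 ltr01)[A0 /(_ A0 (fsubset_refl _)) h] hM.
rewrite -(subrK (\sum_(t <- A0) f t) s); apply: le_trans (ler_normD _ _) _.
by rewrite lerD // ltW.
Qed.

Lemma absummable_le T (f g : T -> K) :
  (forall t, `|f t| <= `|g t|) -> absummable g -> absummable f.
Proof.
move=> fg [M hM]; exists M => A; apply: le_trans (hM A).
exact: ler_sum.
Qed.

Lemma absummableZ T (f : T -> K) (a : K) :
  absummable f -> absummable (fun t => a * f t).
Proof.
move=> [M hM]; exists (`|a| * M) => A.
under eq_bigr do rewrite normrM.
by rewrite -big_distrr /= ler_wpM2l.
Qed.

Lemma absummable_inj T T' (h : T' -> T) (f : T -> K) :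
  injective h -> absummable f -> absummable (f \o h).
Proof.
move=> hI [M hM]; exists M => A.
by have := hM [fset h t | t in A]%fset; rewrite big_imfset //= => x y _ _; apply: hI.
Qed.

(** A finite set of pairs lies in a rectangle, where the sum of norms factors. *)
Lemma absummableX I J (f : I -> K) (g : J -> K) :
  absummable f -> absummable g -> absummable (fun p : I * J => f p.1 * g p.2).
Proof.
move=> [M hM] [N hN]; exists (M * N) => A.
pose A1 := [fset p.1 | p in A]%fset; pose A2 := [fset p.2 | p in A]%fset.
have sA : (A `<=` A1 `*` A2)%fset.
  by apply/fsubsetP => p pA; rewrite inE /= !in_imfset.
apply: (@le_trans _ _ (\sum_(p <- (A1 `*` A2)%fset) `|f p.1 * g p.2|)).
  exact: ler_sum_fset.
rewrite big_fsetX /=.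
under eq_bigr do under eq_bigr do rewrite normrM.
by rewrite -big_distrlr /= ler_pM ?sumr_ge0.
Qed.

End Summation.

(** * Unordered sums of complex numbers *)

(* Unqualified, [Re] is the real part in an abstract numeric closed field. *)
Local Notation Re := complex.Re.

Section ComplexSummation.
Local Open Scope classical_set_scope.
#[local] Existing Instance totally_filter.
Variable R : realType.
Implicit Types T : choiceType.

(** The finite sums of a nonnegative family increase with the finite set, and
    the bound makes their supremum the sum. *)
Lemma hasum_ge0 T (h : T -> R[i]) (M : R[i]) : (forall t, 0 <= h t) ->
  (forall A : {fset T}, \sum_(t <- A) h t <= M) ->
  exists s : R[i], hasum h s.
Proof.
move=> h0 hM; pose E := [set Re (\sum_(t <- A) h t) | A in [set: {fset T}]].
have hsup : has_sup E.
  split; first by exists (Re (\sum_(t <- fset0) h t)); exists fset0.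
  exists (Re M) => _ [A _ <-].
  by have := hM A; rewrite lecE => /andP[].
have real A : \sum_(t <- A) h t = (Re (\sum_(t <- A) h t))%:C.
  by rewrite RRe_real // ger0_real // sumr_ge0.
exists (sup E)%:C; apply/hasumP => e e0.
have eE : e = (Re e)%:C by rewrite RRe_real // gtr0_real.
have Re0 : 0 < Re e by move: e0; rewrite ltcE => /andP[].
have [_ [A0 _ <-] hA0] := sup_adherent Re0 hsup.
exists A0 => A sA; rewrite real -rmorphB /= normc_def /= expr0n /= addr0 sqrtr_sqr.
rewrite eE ltcR ger0_norm ?subr_ge0; last first.
  by apply: sup_upper_bound => //; exists A.
rewrite ltrBlDr -ltrBlDl; apply: lt_le_trans hA0 _.
by have := ler_sum_fset h0 sA; rewrite lecE => /andP[].
Qed.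

(** [Re f] is the difference of the nonnegative families [|f| + Re f] and [|f|]. *)
Lemma hasum_Re T (f : T -> R[i]) : absummable f ->
  exists s, hasum (fun t => (Re (f t))%:C) s.
Proof.
move=> [M hM].
have [s hs] := hasum_ge0 (fun t => normr_ge0 (f t)) hM.
have ReN t : `|(Re (f t))%:C| <= `|f t|.
  apply: le_trans (normc_ge_Re (f t)).
  by rewrite normc_def /= expr0n /= addr0 sqrtr_sqr.
have real t : (Re (f t))%:C \is Num.real by apply/complex_realP; exists (Re (f t)).
have [||s' hs'] := @hasum_ge0 _ (fun t => `|f t| + (Re (f t))%:C) (M + M).
- move=> t; rewrite -lerBlDr sub0r; apply: le_trans (ReN t).
  by rewrite -normrN real_ler_norm // rpredN.
- move=> A; rewrite big_split lerD //; apply: le_trans (hM A).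
  by apply: ler_sum => t _; apply: le_trans (ReN t); rewrite real_ler_norm.
exists (s' + (-1) * s).
have := hasumD hs' (hasumZ (a := -1) hs).
by congr (hasum _ _); apply/funext => t; rewrite mulN1r addrAC subrr add0r.
Qed.

(** The imaginary part of [f] is the real part of [- i f], so the case of real
    parts suffices. *)
Lemma absummable_hasum T (f : T -> R[i]) : absummable f ->
  hasum f (tsum f).
Proof.
move=> af; have [s hs] := hasum_Re af.
have [s' hs'] := hasum_Re (absummableZ (- 'i%C) af).
suff : hasum f (s + 'i%C * s').
  by move=> H; rewrite /hasum; apply: cvgP H.
have := hasumD hs (hasumZ (a := 'i%C) hs').
congr (hasum _ _); apply/funext => t.
rewrite [RHS]complexE; congr (_ + _ * _%:C).
by rewrite mulNr raddfN /= mulrC ReiNIm opprK.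
Qed.

Lemma tsum_nsum (f : nat -> R[i]) s : absummable f -> nsum f s -> tsum f = s.
Proof. by move=> /absummable_hasum/hasum_nsum; apply: nsum_unique. Qed.

End ComplexSummation.

(** * The products (q)_n and the transfer operator *)

Lemma geometric_sum_le (K : numFieldType) (x : K) n : 0 <= x -> x < 1 ->
  \sum_(i < n) x ^+ i <= (1 - x)^-1.
Proof.
move=> x0 x1; have x1' : 0 < 1 - x by rewrite subr_gt0.
rewrite -[leRHS]mul1r ler_pdivlMr // mulrC -opprB mulNr -subrX1 opprB.
by rewrite lerBlDr lerDl exprn_ge0.
Qed.

(** Each factor is at most an exponential, and the exponents have a bounded sum. *)
Lemma prod1D_geometric_bounded (R : realType) (x : R) : 0 <= x -> x < 1 ->
  exists M, forall n, \prod_(j < n) (1 + x ^+ j.+1 / (1 - x)) <= M.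
Proof.
move=> x0 x1; have x1' : 0 < 1 - x by rewrite subr_gt0.
exists (expR ((1 - x)^-1 / (1 - x))) => n.
apply: (@le_trans _ _ (expR (\sum_(j < n) x ^+ j.+1 / (1 - x)))).
  elim: n => [|n IH]; first by rewrite !big_ord0 expR0.
  rewrite !big_ord_recr expRD /=; apply: ler_pM => //.
  - by apply: prodr_ge0 => j _; rewrite addr_ge0 // divr_ge0 ?exprn_ge0 // ltW.
  - by rewrite addr_ge0 // divr_ge0 ?exprn_ge0 // ltW.
  - exact: expR_ge1Dx.
rewrite ler_expR -big_distrl /= ler_pM2r ?invr_gt0 //.
apply: le_trans (geometric_sum_le n x0 x1).
by apply: ler_sum => i _; rewrite exprS ler_piMl ?exprn_ge0 // ltW.
Qed.

Section Pochhammer.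
Variables (R : realType) (q : R[i]).
Hypothesis (hq0 : 0 < `|q|) (hq1 : `|q| < 1).
Local Notation a := (qpoch q q).
Local Notation c := (qpoch_inf q q).

Lemma q_neq0 : q != 0. Proof. by rewrite -normr_gt0. Qed.

Lemma one_sub_qS_neq0 n : 1 - q ^+ n.+1 != 0.
Proof.
rewrite subr_eq0; apply/eqP => h.
have : `|q ^+ n.+1| < 1 by rewrite normrX exprn_ilt1.
by rewrite -h normr1 ltxx.
Qed.

Lemma qpochS n : a n.+1 = a n * (1 - q ^+ n.+1).
Proof. by rewrite /qpoch big_ord_recr /= -exprS. Qed.

Lemma qpoch0 : a 0 = 1. Proof. by rewrite /qpoch big_ord0. Qed.

Lemma qpoch_neq0 n : a n != 0.
Proof.
by elim: n => [|n IH]; rewrite ?qpoch0 ?oner_eq0 // qpochS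
  mulf_neq0 // one_sub_qS_neq0.
Qed.

(** With x = |q|, the factor [1 - q^(j+1)] and its inverse both have norm at most
    1 + x^(j+1) / (1 - x), because x^(j+1) <= x; hence one convergent product
    bounds (q)_n and 1 / (q)_n together. *)
Lemma qpoch_and_inv_bounded :
  exists2 M, 0 < M & forall n, `|a n| <= M /\ `|(a n)^-1| <= M.
Proof.
have nE : `|q| = (Re `|q|)%:C by rewrite RRe_real // normr_real.
set x := Re `|q| in nE.
have x0 : 0 <= x by rewrite -ler0c -nE.
have x1 : x < 1 by rewrite -ltcR -nE.
have x1' : 0 < 1 - x by rewrite subr_gt0.
have [M hM] := prod1D_geometric_bounded x0 x1.
pose Y j := 1 + x ^+ j.+1 / (1 - x).
have Y0 j : 0 < Y j by rewrite ltr_wpDr // divr_ge0 ?exprn_ge0 // ltW.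
have qX j : `|q ^+ j.+1| = (x ^+ j.+1)%:C by rewrite normrX nE rmorphXn.
have xS j : x ^+ j.+1 <= x by rewrite exprS ler_piMr // exprn_ile1 // ltW.
have h1 j : `|1 - q ^+ j.+1| <= (Y j)%:C.
  apply: le_trans (ler_normB _ _) _; rewrite normr1 qX -(rmorph1 (real_complex R)).
  rewrite -rmorphD lecR /= lerD2l ler_pdivlMr // ler_piMr ?exprn_ge0 //.
  by rewrite lerBlDr lerDl.
have h2 j : `|(1 - q ^+ j.+1)^-1| <= (Y j)%:C.
  rewrite normrV ?unitfE ?one_sub_qS_neq0 // -[leLHS]mul1r ler_pdivrMr; last first.
    by rewrite normr_gt0 one_sub_qS_neq0.
  apply: (@le_trans _ _ ((Y j) * (1 - x ^+ j.+1))%:C).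
    rewrite -(rmorph1 (real_complex R)) lecR /Y.
    rewrite -(ler_pM2r x1') mulrDl mulrAC mul1r mulrDl divfK ?gt_eqF //.
    have := xS j; have : 0 <= x ^+ j.+1 by rewrite exprn_ge0.
    by move: (x ^+ j.+1) => y y0 yx; nra.
  rewrite rmorphM rmorphB rmorph1 /= ler_pM2l ?ltcR // -qX.
  by rewrite -[X in X - _](@normr1 R[i]) lerB_dist.
have aP n : `|a n| <= (\prod_(j < n) Y j)%:C.
  rewrite normr_prod rmorph_prod; apply: ler_prod => j _.
  by rewrite normr_ge0 /= -exprS h1.
have aV n : `|(a n)^-1| <= (\prod_(j < n) Y j)%:C.
  rewrite -prodfV normr_prod rmorph_prod; apply: ler_prod => j _.
  by rewrite normr_ge0 /= -exprS h2.
exists M%:C.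
  by rewrite ltcR; apply: lt_le_trans (hM 0%N); rewrite big_ord0.
by move=> n; split; [apply: le_trans (aP n) _ | apply: le_trans (aV n) _];
  rewrite lecR.
Qed.

Lemma absummable_q : absummable (fun n => q ^+ n).
Proof.
exists (1 - `|q|)^-1 => A.
have [N sA] := fset_nat_sub_iota A.
apply: le_trans (ler_sum_fset (fun t => normr_ge0 _) sA) _.
rewrite (sum_fset_iota (fun n => `|q ^+ n|)) big_mkord.
under eq_bigr do rewrite normrX.
exact: geometric_sum_le.
Qed.

Definition bounded_seq (w : nat -> R[i]) :=
  exists M : R[i], forall n, `|w n| <= M.

Lemma absummable_bounded w :
  bounded_seq w -> absummable (fun n => w n * q ^+ n).
Proof.
move=> [M hM]; apply: absummable_le (absummableZ M absummable_q) => n.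
rewrite !normrM ler_wpM2r //; apply: le_trans (hM n) _.
by rewrite real_ler_norm // ger0_real // (le_trans _ (hM 0%N)).
Qed.

(** a_n = 1 - sum_(k < n) a_k q^(k+1), and the series converges absolutely. *)
Lemma qpoch_tends : tends a c.
Proof.
have bS : bounded_seq (fun n => a n * q).
  have [M M0 hM] := qpoch_and_inv_bounded; exists M => n; rewrite normrM.
  by rewrite -[leRHS]mulr1 ler_pM ?normr_ge0 ?(ltW hq1) //; case: (hM n).
have h := hasum_nsum (absummable_hasum (absummable_bounded bS)).
suff : tends a (1 - tsum (fun n => a n * q * q ^+ n)).
  by move=> H; rewrite /qpoch_inf /tends; apply: cvgP H.
have := tendsB (@tends_cst R[i] 1) h; congr (tends _ _); apply/funext => n.
elim: n => [|n IH]; first by rewrite big_geq // subr0 qpoch0.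
by rewrite qpochS mulrBr mulr1 big_nat_recr //= opprD addrA IH exprS mulrA.
Qed.

(** The inverses 1 / (q)_n stay bounded, so (q)_n stays away from 0. *)
Lemma qpoch_inf_neq0 : c != 0.
Proof.
have [M M0 hM] := qpoch_and_inv_bounded; apply/eqP => c0.
have := qpoch_tends => /tendsP/(_ M^-1); rewrite invr_gt0
  => /(_ M0)[N /(_ N (leqnn N))].
rewrite c0 sub0r normrN; have [_] := hM N.
rewrite normrV ?unitfE ?qpoch_neq0 // => h1 h2.
have aN : 0 < `|a N| by rewrite normr_gt0 qpoch_neq0.
have : M^-1 <= `|a N| by rewrite -[leRHS]invrK lef_pV2 // posrE invr_gt0.
by move=> h3; have := lt_le_trans h2 h3; rewrite ltxx.
Qed.

Lemma qpochV_tends : tends (fun n => (a n)^-1) c^-1.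
Proof. exact: tendsV qpoch_inf_neq0 qpoch_tends. Qed.

(** The contribution of a node of value n to a term of a graph series, the edges
    being left out. *)
Definition qweight n := q ^+ n / a n.
Local Notation wt := qweight.

Lemma qweight0 : wt 0 = 1. Proof. by rewrite /qweight qpoch0 expr0 divr1. Qed.

Lemma bounded_mul u v :
  bounded_seq u -> bounded_seq v -> bounded_seq (fun n => u n * v n).
Proof.
by move=> [M hM] [N hN]; exists (M * N) => n; rewrite normrM ler_pM.
Qed.

Lemma bounded_qpochV : bounded_seq (fun n => (a n)^-1).
Proof. by have [M _ hM] := qpoch_and_inv_bounded; exists M => n; case: (hM n). Qed.

Lemma bounded_qpoch : bounded_seq a.
Proof. by have [M _ hM] := qpoch_and_inv_bounded; exists M => n; case: (hM n). Qed.

Lemma absummable_qweight w : bounded_seq w -> absummable (fun n => w n * wt n).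
Proof.
move=> bw; have := absummable_bounded (bounded_mul bw bounded_qpochV).
by congr absummable; apply/funext => n; rewrite /qweight mulrAC mulrA.
Qed.

Lemma bounded_qX m : bounded_seq (fun n => q ^+ (n * m)).
Proof. by exists 1 => n; rewrite normrX exprn_ile1 // ltW. Qed.

(** Summing out an end node that carries the extra weight [w], as a function of
    the value [m] of its neighbour. *)
Definition transfer (w : nat -> R[i]) m :=
  tsum (fun n => w n * wt n * q ^+ (n * m)).

Definition qpairing (u v : nat -> R[i]) :=
  tsum (fun n => u n * v n * wt n).

Lemma absummable_transfer w m :
  bounded_seq w -> absummable (fun n => w n * wt n * q ^+ (n * m)).
Proof.
move=> bw; have := absummable_qweight (bounded_mul bw (bounded_qX m)).
by congr absummable; apply/funext => n; rewrite mulrAC.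
Qed.

Lemma hasum_transfer w m : bounded_seq w ->
  hasum (fun n => w n * wt n * q ^+ (n * m)) (transfer w m).
Proof. by move=> bw; apply: absummable_hasum; apply: absummable_transfer. Qed.

Lemma qpairing_hasum u v : bounded_seq u -> bounded_seq v ->
  hasum (fun n => u n * v n * wt n) (qpairing u v).
Proof.
by move=> bu bv; apply: absummable_hasum; apply/absummable_qweight/bounded_mul.
Qed.

Lemma bounded_transfer w : bounded_seq w -> bounded_seq (transfer w).
Proof.
move=> bw; have [M hM] := absummable_qweight bw; exists (1 + M) => m.
apply: (hasum_norm_le (hasum_transfer (m := m) bw)) => A.
apply: le_trans (ler_norm_sum _ _ _) _; apply: le_trans (hM A).
apply: ler_sum => n _; rewrite normrM ler_piMr // normrX exprn_ile1 // ltW //.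
Qed.

(** Both sides are iterated sums of the double family
    u(n) v(m) w_n w_m q^(nm), in the two orders. *)
Lemma qpairing_transfer u v : bounded_seq u -> bounded_seq v ->
  qpairing (transfer u) v = qpairing u (transfer v).
Proof.
move=> bu bv; pose f (p : nat * nat) :=
  u p.1 * wt p.1 * (v p.2 * wt p.2) * q ^+ (p.1 * p.2).
have af : absummable f.
  apply: absummable_le (absummableX (absummable_qweight bu) (absummable_qweight bv))
    => -[n m].
  by rewrite /f /= normrM ler_piMr // normrX exprn_ile1 // ltW.
have hf := absummable_hasum af.
have h1 : hasum (fun n => u n * transfer v n * wt n) (tsum f).
  apply: (hasum_fubini hf) => n.
  have := hasumZ (a := u n * wt n) (hasum_transfer (m := n) bv).
  rewrite [X in hasum _ X]mulrAC; congr hasum; apply/funext => m.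
  by rewrite /f /= (mulnC m) !mulrA.
have sw : bijective (fun p : nat * nat => (p.2, p.1)).
  by exists (fun p : nat * nat => (p.2, p.1)) => -[].
have h2 : hasum (fun m => transfer u m * v m * wt m) (tsum f).
  apply: (hasum_fubini (hasum_reindex sw hf)) => m.
  have := hasumZ (a := v m * wt m) (hasum_transfer (m := m) bu).
  rewrite [X in hasum _ X]mulrC [X in hasum _ X]mulrA; congr hasum.
  by apply/funext => n; rewrite /f /=; ring.
rewrite -(hasum_unique h1 (qpairing_hasum bu (bounded_transfer bv))).
by rewrite (hasum_unique h2 (qpairing_hasum (bounded_transfer bu) bv)).
Qed.

End Pochhammer.

(** * Closed forms and the two q-series identities *)

Section Values.
Variables (R : realType) (q : R[i]).
Hypothesis (hq0 : 0 < `|q|) (hq1 : `|q| < 1).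
Local Notation a := (qpoch q q).
Local Notation c := (qpoch_inf q q).
Local Notation wt := (qweight q).
Local Notation L := (transfer q).
Local Notation D := (Dser q).
Local Notation G := (Gser q).

Let q0 := q_neq0 hq0.
Let aN0 := qpoch_neq0 hq1.
Let uN0 := one_sub_qS_neq0 hq1.
Let cN0 := qpoch_inf_neq0 hq1.

Definition ones (n : nat) : R[i] := 1.
Definition recip n : R[i] := (1 - q ^+ n.+1)^-1.
(** The closed form of [L recip], established in [transfer_recip]. *)
Definition recip_transfer n : R[i] := q ^- n.+1 * (a n / c - 1).

Local Notation r := recip.
Local Notation s := recip_transfer.

Lemma bounded_ones : bounded_seq ones.
Proof. by exists 1 => n; rewrite normr1. Qed.

(** Euler's identity sum_n x^n / (q)_n = 1 / (x; q)_oo at x = q^(m+1). For m = 0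
    the partial sums telescope to 1 / (q)_n. The step from m to m + 1 multiplies
    the term by q^n, and (1 - q^n) / (q)_n = 1 / (q)_(n-1) shows that the series
    decreases by q^(m+1) times itself. *)
Lemma nsum_qweight m : nsum (fun n => wt n * q ^+ (n * m)) (a m / c).
Proof.
elim: m => [|m IH].
  rewrite qpoch0 div1r; apply/tendsS; have := qpochV_tends hq1.
  congr (tends _ _); apply/funext => n; elim: n => [|n IH].
    by rewrite big_nat1 muln0 mulr1 qweight0 qpoch0 invr1.
  rewrite big_nat_recr //= -IH muln0 mulr1 /qweight qpochS.
  by field; rewrite aN0 uN0.
have step : nsum (fun n => wt n * q ^+ (n * m) - wt n * q ^+ (n * m.+1))
    (0 + q ^+ m.+1 * (a m / c)).
  have -> : 0 = wt 0%N * q ^+ (0 * m) - wt 0%N * q ^+ (0 * m.+1).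
    by rewrite !mul0n subrr.
  apply: nsum_cons; apply: (nsum_ext (nsumZ (x := q ^+ m.+1) IH)) => // n.
  have -> : (n.+1 * m.+1 = m + n * m + n.+1)%N by rewrite !mulSn mulnS; ring.
  rewrite /qweight qpochS mulSn !exprD !exprS.
  by field; rewrite aN0 -exprS uN0.
by apply: (nsum_ext (nsumD IH (nsumZ (x := -1) step))) => [n|]; rewrite ?qpochS; ring.
Qed.

Arguments nsum_qweight : clear implicits.

(** Absolute convergence gives a sum [t], and removing the first term gives
    t - 1 = q^(m+1) t. *)
Lemma nsum_geometric m : nsum (fun n => q ^+ (n * m.+1)) (r m).
Proof.
have ab : absummable (fun n => q ^+ (n * m.+1)).
  apply: absummable_le (absummable_q hq1) => n; rewrite 
    mulnS exprD normrM ler_piMr //.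
  by rewrite normrX exprn_ile1 // ltW.
have h := hasum_nsum (absummable_hasum ab).
set t := tsum _ in h.
have e : t - 1 = q ^+ m.+1 * t.
  apply: (nsum_unique (f := fun n => q ^+ (n.+1 * m.+1))).
    by have := nsumS h; rewrite mul0n expr0.
  by apply: (nsum_ext (nsumZ (x := q ^+ m.+1) h)) => // n; rewrite mulSn exprD.
suff <- : t = r m by [].
apply: (mulIf (uN0 m)); rewrite /recip mulVf ?uN0 // mulrBr mulr1 [t * _]mulrC -e.
by ring.
Qed.

Arguments nsum_geometric : clear implicits.

Lemma transfer_ones m : L ones m = a m / c.
Proof.
apply: tsum_nsum; first by apply: absummable_transfer => //; exact: bounded_ones.
by apply: (nsum_ext (nsum_qweight m)) => // n; rewrite mul1r.
Qed.

Lemma transfer_qpoch m : L a m = r m.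
Proof.
apply: tsum_nsum; first by apply: absummable_transfer => //; exact: bounded_qpoch.
apply: (nsum_ext (nsum_geometric m)) => // n.
by rewrite /qweight mulnS exprD mulrC; field; rewrite aN0.
Qed.

Lemma bounded_recip : bounded_seq r.
Proof.
have -> : r = L a by apply/funext => m; rewrite transfer_qpoch.
by apply: bounded_transfer => //; exact: bounded_qpoch.
Qed.

(** Dividing by 1 - q^(n+1) turns (q)_n into (q)_(n+1), so this is Euler's series
    without its first term. *)
Lemma transfer_recip m : L r m = s m.
Proof.
apply: tsum_nsum; first by apply: absummable_transfer => //; exact: bounded_recip.
have := nsumZ (x := q ^- m.+1) (nsumS (nsum_qweight m)).
rewrite mul0n expr0 qweight0 mulr1 => h; apply: (nsum_ext h) => // n.
rewrite /qweight /recip qpochS mulSn !exprD !exprS.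
by field; rewrite aN0 -exprS uN0 expf_neq0 q0.
Qed.

Lemma bounded_recip_transfer : bounded_seq s.
Proof.
have -> : s = L r by apply/funext => m; rewrite transfer_recip.
by apply: bounded_transfer => //; exact: bounded_recip.
Qed.

Lemma recip_transfer_qweight n : s n * wt n = q^-1 / c * (1 - c / a n).
Proof.
by rewrite /recip_transfer /qweight exprS; field; rewrite aN0 cN0 q0 expf_neq0.
Qed.

Lemma qpairing_nsum v w : bounded_seq v -> bounded_seq w ->
  nsum (fun n => v n * w n * wt n) (qpairing q v w).
Proof. by move=> bv bw; apply/hasum_nsum/qpairing_hasum. Qed.

(** The two sides of <L r, 1> = <r, L 1>, rescaled by q c: the right side
    is the Lambert series that defines D. *)
Lemma D_sums : nsum (fun n => q ^+ n.+1 / (1 - q ^+ n.+1)) D /\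
  nsum (fun n => 1 - c / a n) D.
Proof.
have e := qpairing_transfer hq1 bounded_recip bounded_ones.
have h1 := nsumZ (x := q * c)
  (qpairing_nsum (bounded_transfer hq1 bounded_recip) bounded_ones).
have h2 := nsumZ (x := q * c)
  (qpairing_nsum bounded_recip (bounded_transfer hq1 bounded_ones)).
rewrite e in h1; set P := q * c * _ in h1 h2.
have H2 : nsum (fun n => q ^+ n.+1 / (1 - q ^+ n.+1)) P.
  apply: (nsum_ext h2) => // n; rewrite transfer_ones /recip /qweight exprS.
  by field; rewrite aN0 cN0 -exprS uN0.
have -> : D = P.
  apply: (tends_lim (u := fun N => \sum_(1 <= n < N) q ^+ n / (1 - q ^+ n))).
  apply/tendsS; move: H2; congr (tends _ _); apply/funext => n.
  by rewrite big_add1.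
split=> //; apply: (nsum_ext h1) => // n; rewrite transfer_recip mulr1
  recip_transfer_qweight.
by field; rewrite aN0 cN0 q0.
Qed.

(** The two sides of <L r, a> = <r, L a>, rescaled by q c: the left side
    is the series that defines G. *)
Lemma G_sums : nsum (fun n => a n - c) G /\
  nsum (fun n => c / a n.+1 * (q ^+ n.+1 / (1 - q ^+ n.+1))) G.
Proof.
have e := qpairing_transfer hq1 bounded_recip (bounded_qpoch hq1).
have h1 := nsumZ (x := q * c)
  (qpairing_nsum (bounded_transfer hq1 bounded_recip) (bounded_qpoch hq1)).
have h2 := nsumZ (x := q * c)
  (qpairing_nsum bounded_recip (bounded_transfer hq1 (bounded_qpoch hq1))).
rewrite e in h1; set P := q * c * _ in h1 h2.
have H1 : nsum (fun n => a n - c) P.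
  apply: (nsum_ext h1) => // n; rewrite transfer_recip
    [s n * a n * _]mulrAC recip_transfer_qweight.
  by field; rewrite aN0 cN0 q0.
have -> : G = P by exact: tends_lim H1.
split=> //; apply: (nsum_ext h2) => // n; rewrite transfer_qpoch
  /recip /qweight qpochS exprS.
by field; rewrite aN0 -exprS uN0.
Qed.

(** With h(n) = q^(-n) (a_n - c)^2 / a_n and S = sum_n h(n), the difference
    h(n) - q h(n+1) equals q ((a_n - c) + c (1 - c / a_(n+1))); its sum is known
    from [D_sums] and [G_sums], while it is also S - q (S - h(0)). *)
Lemma qpairing_recip_transfer : qpairing q s s =
  q^-1 / ((1 - q) * c ^+ 2) * (- 1 + c * D + G + c).
Proof.
have [_ D2] := D_sums; have [G1 _] := G_sums.
pose h n := (a n - c) ^+ 2 / a n / q ^+ n.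
have hS : nsum h (q ^+ 2 * c ^+ 2 * qpairing q s s).
  apply: (nsum_ext (nsumZ (x := q ^+ 2 * c ^+ 2)
    (qpairing_nsum bounded_recip_transfer bounded_recip_transfer))) => // n.
  rewrite -[s n * s n * _]mulrA recip_transfer_qweight /h /recip_transfer
    (exprS q n).
  by field; rewrite aN0 cN0 q0 expf_neq0.
set S := q ^+ 2 * c ^+ 2 * _ in hS.
have h1 := nsumD hS (nsumZ (x := - q) (nsumS hS)).
have h2 := nsumZ (x := q) (nsumD G1 (nsumZ (x := c) (nsumS D2))).
have e : S + - q * (S - h 0%N) = q * (G + c * (D - (1 - c / a 0))).
  apply: (nsum_unique h1); apply: (nsum_ext h2) => // n.
  rewrite /h qpochS !exprS.
  by field; rewrite aN0 -exprS uN0 q0 expf_neq0.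
have q1 : 1 - q != 0 by have := uN0 0; rewrite expr1.
have e2 : S = q / (1 - q) * (- 1 + c * D + G + c).
  apply: (mulfI q1); rewrite [RHS](_ : _ = q * (- 1 + c * D + G + c)); last by field.
  move: e; rewrite /h qpoch0 expr0 => e.
  have -> : (1 - q) * S = S + - q * (S - (1 - c) ^+ 2 / 1 / 1) - q * (1 - c) ^+ 2.
    by rewrite !divr1; ring.
  by rewrite e divr1; ring.
have -> : qpairing q s s = S / (q ^+ 2 * c ^+ 2).
  by rewrite /S; field; rewrite cN0 q0.
by rewrite e2; field; rewrite cN0 q0 q1.
Qed.

(** The weighted terms are 1 - c / a_n up to a factor. For m > 0 the two halves
    converge separately, to a geometric and to an Euler series; for m = 0 only
    their difference is summable, and its sum is D. *)
Lemma transfer_recip_transfer m :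
  L s m = q^-1 / c * (if m is k.+1 then r k - a k else D).
Proof.
apply: tsum_nsum; first by apply: absummable_transfer => //; exact: bounded_recip_transfer.
case: m => [|k].
  apply: (nsum_ext (nsumZ (D_sums).2)) => // n.
  by rewrite recip_transfer_qweight muln0 mulr1.
have h := nsumD (nsum_geometric k) (nsumZ (x := - c) (nsum_qweight k)).
apply: (nsum_ext (nsumZ (x := q^-1 / c) h)) => [n|].
  by rewrite recip_transfer_qweight /qweight mulnS exprD; field; rewrite aN0 cN0 q0.
by field; rewrite cN0 q0.
Qed.

(** With x = q^(k+1) / (1 - q^(k+1)), so that r k = 1 + x, the term of index
    k + 1 is, up to the factor q^-2 c^-2,
    (1 - c / a_(k+1)) - (a_k - c) + (1 + c) x - (c / a_(k+1)) x,
    whose four parts are summed by [D_sums] and [G_sums]. *)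
Lemma qpairing_transfer_recip_transfer : qpairing q (L s) s =
  q ^- 2 / c ^+ 2 * (- 1 + c + 3 * D - 2 * G).
Proof.
have [D1 D2] := D_sums; have [G1 G2] := G_sums.
have h1 := nsumZ (x := q ^+ 2 * c ^+ 2)
  (qpairing_nsum (bounded_transfer hq1 bounded_recip_transfer) bounded_recip_transfer).
have t1 := nsumD (nsumS D2) (nsumZ (x := -1) G1).
have t2 := nsumD (nsumZ (x := 1 + c) D1) (nsumZ (x := -1) G2).
have e : q ^+ 2 * c ^+ 2 * qpairing q (L s) s = D * (1 - c) +
   (D - (1 - c / a 0) + -1 * G + ((1 + c) * D + -1 * G)).
  apply: (nsum_unique h1).
  have -> : D * (1 - c) = q ^+ 2 * c ^+ 2 * (L s 0 * s 0 * wt 0).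
    by rewrite -[L s 0 * s 0 * _]mulrA recip_transfer_qweight transfer_recip_transfer
      qpoch0; field; rewrite cN0 q0.
  apply: (nsum_cons (f := fun n => q ^+ 2 * c ^+ 2 * (L s n * s n * wt n))).
  apply: (nsum_ext (nsumD t1 t2)) => // n.
  rewrite -[L s n.+1 * s n.+1 * _]mulrA recip_transfer_qweight
    transfer_recip_transfer /recip qpochS.
  by field; rewrite aN0 cN0 q0 uN0.
have -> : qpairing q (L s) s = q ^+ 2 * c ^+ 2 * qpairing q (L s) s / (q ^+ 2 * c ^+ 2).
  by field; rewrite cN0 q0.
by rewrite e qpoch0; field; rewrite cN0 q0.
Qed.

End Values.

(** * Summation along the path *)

Section Paths.
#[local] Existing Instance totally_filter.
Variables (R : realType) (q : R[i]).
Hypothesis (hq0 : 0 < `|q|) (hq1 : `|q| < 1).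
Local Notation a := (qpoch q q).
Local Notation c := (qpoch_inf q q).
Local Notation wt := (qweight q).
Local Notation L := (transfer q).

Lemma absummable_tuple (f : nat -> R[i]) k : absummable f ->
  absummable (fun t : k.-tuple nat => \prod_(i < k) f (tnth t i)).
Proof.
move=> af; elim: k => [|k IH].
  exists 1 => A; apply: le_trans (ler_sum_fset _ (_ : (A `<=` [fset [tuple]])%fset)) _.
  - by move=> t; exact: normr_ge0.
  - by apply/fsubsetP => t _; rewrite inE tuple0.
  - by rewrite big_seq_fset1 big_ord0 normr1.
have inj : injective (fun t : k.+1.-tuple nat => (thead t, [tuple of behead t])).
  move=> t t' [h1 h2]; rewrite (tuple_eta t) (tuple_eta t') h1.
  by apply: val_inj => /=; rewrite h2.
have := absummable_inj inj (absummableX af IH).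
congr absummable; apply/funext => t /=; rewrite big_ord_recl; congr (_ * _).
by apply: eq_bigr => i _; rewrite !(tnth_nth 0%N) /= nth_behead.
Qed.

Lemma path_term_cons k n (t : k.+1.-tuple nat) :
  path_term q [tuple of n :: t] = wt n * q ^+ (n * thead t) * path_term q t.
Proof.
rewrite /path_term.
have -> : path_exponent [tuple of n :: t] = (n + n * thead t + path_exponent t)%N.
  rewrite /path_exponent /= big_ord_recl [X in (_ + X)%N = _]big_ord_recl /=.
  have -> : nth 0%N t 0 = thead t by rewrite /thead (tnth_nth 0%N).
  have -> : (\sum_(i < k.+1) tnth [tuple of n :: t] (lift ord0 i) =
             \sum_(i < k.+1) tnth t i)%N.
    by apply: eq_bigr => i _; rewrite tnthS.
  rewrite tnth0 /=; ring.
rewrite big_ord_recl tnth0 !exprD invfM.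
have -> : \prod_(i < k.+1) a (tnth [tuple of n :: t] (lift ord0 i)) =
    \prod_(i < k.+1) a (tnth t i).
  by apply: eq_bigr => i _; rewrite tnthS.
by rewrite /qweight; ring.
Qed.

(** Dropping the edge factors q^(n_i n_(i+1)), of norm at most 1, and bounding
    1 / (q)_n by a constant leaves a product of geometric families. *)
Lemma absummable_path_term k : absummable (@path_term R k q).
Proof.
have [M M0 hM] := qpoch_and_inv_bounded hq1.
have aw : absummable (fun n => M * q ^+ n) by apply/absummableZ/absummable_q.
apply: absummable_le (absummable_tuple k aw) => t.
rewrite /path_term normrM normrX normfV !normr_prod.
under [leRHS]eq_bigr do rewrite normrM normrX (ger0_norm (ltW M0)).
rewrite big_split /= prodrXr -prodfV mulrC; apply: ler_pM.
- by apply: prodr_ge0 => i _.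
- by rewrite exprn_ge0.
- by apply: ler_prod => i _; rewrite invr_ge0 normr_ge0 -normfV; case: (hM (tnth t i)).
- by rewrite /path_exponent exprD ler_piMl ?exprn_ge0 // exprn_ile1 // ltW.
Qed.

(** Summing over the first entry of a tuple turns the weight [w] on that entry
    into the weight [L w] on the next one. *)
Lemma hasum_path k w : bounded_seq w ->
  hasum (fun t : k.+1.-tuple nat => w (thead t) * path_term q t)
    (qpairing q (iter k L w) (@ones R)).
Proof.
elim: k w => [|k IH] w bw.
  have hb : bijective (fun t : 1.-tuple nat => thead t).
    exists (fun n => [tuple n]) => [t|n]; last exact: theadE.
    by case/tupleP: t => n t; rewrite (tuple0 t); apply: val_inj.
  have := hasum_reindex hb (qpairing_hasum hq1 bw (@bounded_ones R)).
  congr hasum; apply/funext => t; rewrite /= mulr1; congr (_ * _).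
  rewrite /path_term /path_exponent big_ord0 !big_ord_recl !big_ord0 addn0.
  by rewrite mulr1.
have [M hM] := bw.
have af : absummable (fun t : k.+2.-tuple nat => w (thead t) * path_term q t).
  apply: absummable_le (absummableZ M (absummable_path_term k.+2)) => t;
    rewrite !normrM ler_wpM2r //.
  by rewrite (ger0_norm (le_trans (normr_ge0 _) (hM 0%N))).
have hf := absummable_hasum af.
pose e (p : k.+1.-tuple nat * nat) := [tuple of p.2 :: p.1].
have eb : bijective e.
  exists (fun t : k.+2.-tuple nat => ([tuple of behead t], thead t)).
    by move=> [t n]; rewrite /e /= theadE; congr (_, _); apply: val_inj.
  by move=> t; rewrite /e /= -tuple_eta.
have h : hasum (fun t : k.+1.-tuple nat => L w (thead t) * path_term q t)
    (tsum (fun t : k.+2.-tuple nat => w (thead t) * path_term q t)).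
  apply: (hasum_fubini (hasum_reindex eb hf)) => t.
  have := hasumZ (a := path_term q t) (hasum_transfer hq1 (m := thead t) bw).
  rewrite [X in hasum _ X]mulrC; congr hasum; apply/funext => n.
  by rewrite /e /= theadE path_term_cons; ring.
rewrite iterSr -(hasum_unique h (IH _ (bounded_transfer hq1 bw))).
exact: hf.
Qed.

Lemma transfer_scale x w m : bounded_seq w -> L (fun n => x * w n) m = x * L w m.
Proof.
move=> bw; apply: tsum_nsum.
  have := absummableZ x (absummable_transfer hq1 m bw).
  by congr absummable; apply/funext => n; rewrite !mulrA.
have := nsumZ (x := x) (hasum_nsum (hasum_transfer hq1 (m := m) bw)).
by congr nsum; apply/funext => n; rewrite !mulrA.
Qed.

Lemma qpairing_scale x y v w : bounded_seq v -> bounded_seq w ->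
  qpairing q (fun n => x * v n) (fun n => y * w n) = x * y * qpairing q v w.
Proof.
move=> bv bw; apply: tsum_nsum.
  have := absummableZ (x * y) (absummable_qweight hq1 (bounded_mul bv bw)).
  by congr absummable; apply/funext => n; ring.
have := nsumZ (x := x * y) (qpairing_nsum hq1 bv bw).
by congr nsum; apply/funext => n; ring.
Qed.

Lemma iter3_transfer_ones : iter 3 L (@ones R) = fun n => c^-1 * recip_transfer q n.
Proof.
have E1 : L (@ones R) = fun n => c^-1 * a n.
  by apply/funext => n; rewrite transfer_ones // mulrC.
have E2 : L (fun n => c^-1 * a n) = fun n => c^-1 * recip q n.
  by apply/funext => n; rewrite transfer_scale ?transfer_qpoch //;
    exact: bounded_qpoch.
rewrite /= E1 E2; apply/funext => n; 
  rewrite transfer_scale ?transfer_recip //; exact: bounded_recip.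
Qed.

(** Self-adjointness moves the [j] transfers performed last to the other
    argument. *)
Lemma qpairing_iter_transfer i j v w : bounded_seq v -> bounded_seq w ->
  qpairing q (iter (i + j) L v) w = qpairing q (iter i L v) (iter j L w).
Proof.
elim: j w => [|j IH] w bv bw; first by rewrite addn0.
have bi n x : bounded_seq x -> bounded_seq (iter n L x).
  by move=> bx; elim: n => // n; exact: bounded_transfer.
rewrite addnS iterS qpairing_transfer ?IH ?iterSr //; first exact: bounded_transfer.
exact: bi.
Qed.

Lemma path_seriesE k : path_series_cvg k.+1 q /\
  path_series k.+1 q = qpairing q (iter k L (@ones R)) (@ones R).
Proof.
have h := hasum_path (k := k) (@bounded_ones R).
have h' : hasum (@path_term R k.+1 q) (qpairing q (iter k L (@ones R)) (@ones R)).
  by move: h; congr hasum; apply/funext => t; rewrite mul1r.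
split; first exact: cvgP h'.
apply: hasum_unique h'; exact: absummable_hasum (absummable_path_term k.+1).
Qed.

End Paths.

Theorem theorem1p1 (R : realType) (q : R[i]) (hq0 : 0 < `|q|)
    (hq1 : `|q| < 1) :
  (path_series_cvg 7 q /\
   path_series 7 q =
     q^-1 / ((1 - q) * qpoch_inf q q ^+ 4) *
     (- 1 + qpoch_inf q q * Dser q + Gser q + qpoch_inf q q)) /\
  (path_series_cvg 8 q /\
   path_series 8 q =
     q ^- 2 / qpoch_inf q q ^+ 4 *
     (- 1 + qpoch_inf q q + 3 * Dser q - 2 * Gser q)).
Proof.
have [c7 ->] := path_seriesE hq1 6; have [c8 ->] := path_seriesE hq1 7.
have b1 := @bounded_ones R; have bs := bounded_recip_transfer hq0 hq1.
have q0 := q_neq0 hq0; have cN0 := qpoch_inf_neq0 hq1.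
have q1 : 1 - q != 0 by have := one_sub_qS_neq0 hq1 0; rewrite expr1.
split; split => //.
  rewrite (qpairing_iter_transfer hq1 3 3) // iter3_transfer_ones //
    qpairing_scale // qpairing_recip_transfer //.
  by field; rewrite cN0 q0 q1.
rewrite (qpairing_iter_transfer hq1 4 3) // iterS iter3_transfer_ones //.
have -> : transfer q (fun n => (qpoch_inf q q)^-1 * recip_transfer q n) =
    fun n => (qpoch_inf q q)^-1 * transfer q (recip_transfer q) n.
  by apply/funext => m; rewrite transfer_scale.
rewrite qpairing_scale ?qpairing_transfer_recip_transfer //; last
  exact: bounded_transfer.
by field; rewrite cN0 q0.
Qed.
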